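(* Let $A\in\mathscr R$ be a fixed set and let $\mathbf X^{(1)},\mathbf X^{(2)},\ldots$ be independent random vectors in $[0,\infty)^d$ with common distribution $F\in\mathcal S_A$. Let $N$ be a discrete (integer-valued), non-negative random variable, not degenerate at zero, independent of $\{\mathbf X^{(1)},\mathbf X^{(2)},\ldots\}$, such that $\mathbf E[N]<\infty$ and $\mathbf E[(1+\varepsilon)^N]<\infty$ for some $\varepsilon>0$. Put $\mathbf S_N=\sum_{i=1}^N\mathbf X^{(i)}$ (with $\mathbf S_0=\mathbf 0$). Then $$\mathbf P[\mathbf S_N\in xA]\sim\mathbf E[N]\,F(xA),\qquad x\to\infty,$$ and moreover the distribution of $\mathbf S_N$ belongs to $\mathcal S_A$.
   Context: Fix an integer $d\ge 1$. $\mathscr R$ is the family of nonempty sets $A\subsetneq\mathbb R^d$ that are open, increasing (if $\mathbf x\in A$ and $\mathbf a\in[0,\infty)^d$ then $\mathbf x+\mathbf a\in A$), have convex complement $A^c$, and satisfy $\mathbf 0\notin\overline A$ (closure). For a random vector $\mathbf X$ in $[0,\infty)^d$ with distribution $F$ write $F(xA):=\mathbf P[\mathbf X\in xA]$, put $Y_A:=\sup\{u>0:\mathbf X\in uA\}$ (with $\sup\emptyset=0$), and let $F_A$ be the distribution of $Y_A$; its tail is $\overline F_A(x)=\mathbf P[Y_A>x]=\mathbf P[\mathbf X\in xA]$ for $x>0$. A distribution $V$ on $[0,\infty)$ with tail $\overline V=1-V$, $\overline V(x)>0$ for all $x\ge0$, belongs to $\mathcal S$ (subexponential) if $\lim_{x\to\infty}\overline{V^{n*}}(x)/\overline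 V(x)=n$ for every (equivalently, some) integer $n\ge2$, $V^{n*}$ being the $n$-fold convolution. $F\in\mathcal S_A$ means $F_A\in\mathcal S$. $f\sim g$ means $f(x)/g(x)\to1$ as $x\to\infty$. *)

(* Defs.v *)
From HB Require Import structures.
From mathcomp Require Import all_boot all_order all_algebra.
From mathcomp Require Import finmap.
From mathcomp Require Import all_classical all_reals all_analysis measurable_realfun.

Set Implicit Arguments.
Unset Strict Implicit.
Unset Printing Implicit Defensive.

Import Order.TTheory GRing.Theory Num.Theory.
Import numFieldNormedType.Exports.

Local Open Scope classical_set_scope.
Local Open Scope ring_scope.

(* The Borel sigma-algebra, generated by the open sets. *)
HB.instance Definition _ (R : realType) (m n : nat) :=
  @isMeasurable.Build (sigma_display (@open 'M[R]_(m, n))) 'M[R]_(m, n)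
    <<s @open 'M[R]_(m, n) >>
    (@sigma_algebra0 _ setT (@open 'M[R]_(m, n)))
    (@sigma_algebraC _ (@open 'M[R]_(m, n)))
    (@sigma_algebra_bigcup _ setT (@open 'M[R]_(m, n))).

Section Borel.
Variables (R : realType) (d : nat).

Lemma open_measurable_rV (U : set 'rV[R]_d) : open U -> measurable U.
Proof. by move=> oU; exact: sub_sigma_algebra. Qed.

Lemma measurable_coord (j : 'I_d) :
  measurable_fun setT (fun x : 'rV[R]_d => x ord0 j).
Proof.
apply: (measurability _ (RGenOpens.measurableE R)) => _ [_ [a [b ->] <-]].
rewrite setTI; apply: open_measurable_rV.
apply: open_comp; last exact: interval_open.
by move=> x _; exact: coord_continuous.
Qed.

Lemma measurable_rV disp (T : measurableType disp) (f : T -> 'rV[R]_d) :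
  (forall j, measurable_fun setT (fun w => f w ord0 j)) ->
  measurable_fun setT f.
Proof.
move=> mf; apply: (measurability (@open 'rV[R]_d)) => // _ [U oU <-].
rewrite setTI.
pose box (q : 'rV[rat]_d * nat) : set 'rV[R]_d :=
  [set x | forall j, `|x ord0 j - ratr (q.1 ord0 j)| < q.2.+1%:R^-1].
have -> : f @^-1` U =
    \bigcup_(q in [set q | box q `<=` U]) f @^-1` (box q).
  apply/seteqP; split=> [w /= Uw|w [q qU] /qU//].
  have [e /= e0 eU] : exists2 e : R, 0 < e & ball (f w) e `<=` U.
    by apply/nbhs_ballP; rewrite nbhsE; exists U.
  have [n ne] : exists n : nat, n.+1%:R^-1 < e / 2 :> R.
    have [n _ /(_ n (leqnn n))] := near_infty_natSinv_lt (PosNum (divr_gt0 e0 (ltr0Sn R 1))).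
    by move=> h; exists n.
  have n0 : 0 < n.+1%:R^-1 :> R by rewrite invr_gt0.
  have hq j : exists q : rat, `|f w ord0 j - ratr q| < n.+1%:R^-1.
    have := @rat_in_itvoo R (f w ord0 j - n.+1%:R^-1) (f w ord0 j + n.+1%:R^-1).
    case; first by rewrite ltrD2l gt0_cp.
    by move=> q; rewrite in_itv/= => xq; exists q; rewrite distrC ltr_distl.
  have [q hqq] := choice hq.
  exists (\row_j q j, n) => /= [x /= xq|j]; last by rewrite mxE; exact: hqq.
  apply: eU; split=> // i j; rewrite ord1 /ball/=.
  have := xq j; rewrite mxE => xj.
  rewrite -(subrKA (ratr (q j))) (le_lt_trans (ler_normD _ _))//.
  rewrite [e]splitr ltrD//; first exact: lt_trans (hqq j) ne.
  by rewrite distrC; exact: lt_trans xj ne.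
rewrite bigcup_mkcond; apply: countable_bigcupT_measurable => [|q].
  exact: countableP.
case: ifP => // _.
rewrite (_ : f @^-1` (box q) = \bigcap_(j in [set: 'I_d])
    (fun w => f w ord0 j) @^-1`
    `]ratr (q.1 ord0 j) - q.2.+1%:R^-1, ratr (q.1 ord0 j) + q.2.+1%:R^-1[).
  apply: fin_bigcap_measurable => [|j _]; first exact: finite_finset.
  by rewrite -[X in measurable X]setTI; exact: mf.
apply/seteqP; split=> [w h j _|w h j] /=.
  by rewrite in_itv/= -ltr_distl; exact: h.
by have := h j I; rewrite /= in_itv/= -ltr_distl.
Qed.

End Borel.

Section Convolution.
Variable R : realType.
Implicit Types mu nu : probability R R.

Definition convolution mu nu : set R -> \bar R :=
  pushforward (mu \x nu)%E (fun z : R * R => z.1 + z.2).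

Lemma measurable_add : measurable_fun setT (fun z : R * R => z.1 + z.2).
Proof. exact: measurable_funD. Qed.

Lemma convolution0 mu nu : convolution mu nu set0 = 0%E.
Proof. by rewrite /convolution /pushforward preimage_set0 measure0. Qed.

Lemma convolution_ge0 mu nu B : (0 <= convolution mu nu B)%E.
Proof. by rewrite /convolution /pushforward measure_ge0. Qed.

Lemma convolution_sigma_additive mu nu :
  semi_sigma_additive (convolution mu nu).
Proof.
move=> F mF tF mUF; rewrite /convolution /pushforward preimage_bigcup.
apply: measure_semi_sigma_additive.
- by move=> n; rewrite -[X in measurable X]setTI; exact: measurable_add.
- apply/trivIsetP => /= i j _ _ ij; rewrite -preimage_setI.
  by move/trivIsetP : tF => /(_ _ _ _ _ ij) ->//; rewrite preimage_set0.
- by rewrite -preimage_bigcup -[X in measurable X]setTI; exact: measurable_add.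
Qed.

HB.instance Definition _ mu nu := isMeasure.Build _ _ _ (convolution mu nu)
  (convolution0 mu nu) (convolution_ge0 mu nu)
  (@convolution_sigma_additive mu nu).

Lemma convolutionT mu nu : convolution mu nu setT = 1%E.
Proof.
rewrite /convolution /pushforward preimage_setT -setXTT.
rewrite product_measure1E// -[RHS]mule1.
by congr (_ * _)%E; exact: probability_setT.
Qed.

HB.instance Definition _ mu nu := Measure_isProbability.Build _ _ _
  (convolution mu nu) (convolutionT mu nu).

End Convolution.

Section Subexponential.
Variable R : realType.
Implicit Types V : probability R R.

(* $V^{n*}$, with $V^{0*}$ the unit mass at 0. *)
Fixpoint convolution_power V (n : nat) : probability R R :=
  if n is m.+1 then convolution (convolution_power V m) V else \d_(0 : R).

Definition tail V (x : R) : R := fine (V `]x, +oo[%classic).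

(* In ring_scope, [+oo] is the filter of neighborhoods of $+\infty$ in R. *)
Definition asymp_equiv (f g : R -> R) : Prop := f x / g x @[x --> +oo] --> (1 : R).

Definition subexponential V : Prop :=
  [/\ V `[0, +oo[%classic = 1%E,
      forall x, 0 <= x -> 0 < tail V x &
      forall n, (2 <= n)%N ->
        tail (convolution_power V n) x / tail V x @[x --> +oo] --> (n%:R : R)].

End Subexponential.

Section RareSets.
Variables (R : realType) (d : nat).

Definition orthant : set 'rV[R]_d := [set x | forall j, 0 <= x ord0 j].

Definition increasing_set (A : set 'rV[R]_d) : Prop :=
  forall x a, A x -> orthant a -> A (x + a).

(* The family $\mathscr R$. *)
Record rare_set := RareSet {
  rare_car :> set 'rV[R]_d;
  rare_nonempty : rare_car !=set0;
  rare_proper : rare_car `<` setT;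
  rare_open : open rare_car;
  rare_increasing : increasing_set rare_car;
  rare_convexC : convex_set (~` rare_car : set (convex_lmodType 'rV[R]_d));
  rare_not0 : ~ closure rare_car 0 }.

Definition dilate (u : R) (A : set 'rV[R]_d) : set 'rV[R]_d :=
  [set u *: a | a in A].

(* $Y_A$ as a function of the vector; in R, [sup set0 = 0], and the set is
   bounded when 0 is not in the closure of A ([Yfun_has_ubound]). *)
Definition Yfun (A : set 'rV[R]_d) (x : 'rV[R]_d) : R :=
  sup [set u | 0 < u /\ dilate u A x].

Lemma dilate_open (u : R) (A : set 'rV[R]_d) :
  0 < u -> open A -> open (dilate u A).
Proof.
move=> u0 oA.
have -> : dilate u A = ( *:%R u^-1) @^-1` A.
  apply/seteqP; split=> [_ [a Aa <-]|x Ax] /=.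
    by rewrite scalerA mulVf ?gt_eqF// scale1r.
  by exists (u^-1 *: x) => //; rewrite scalerA mulfV ?gt_eqF// scale1r.
by apply: open_comp => // x _; exact: scaler_continuous.
Qed.

Lemma Yfun_has_ubound (A : rare_set) (x : 'rV[R]_d) :
  has_ubound [set u | 0 < u /\ dilate u A x].
Proof.
have [e e0 eA] : exists2 e : R, 0 < e & forall a, rare_car A a -> e <= `|a|.
  apply: contrapT => h; apply: (@rare_not0 A) => B /nbhs_ballP[e /= e0 eB].
  apply: contrapT => AB; apply: h; exists e => // a Aa.
  rewrite leNgt; apply/negP => ae; apply: AB; exists a; split=> //; apply: eB.
  by rewrite -ball_normE /ball_/= sub0r normrN.
exists (`|x| / e) => u [u0 [a Aa <-]].
by rewrite normrZ gtr0_norm// ler_pdivlMr// ler_pM2l// eA.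
Qed.

Lemma Yfun_ge0 (A : rare_set) (x : 'rV[R]_d) : 0 <= Yfun A x.
Proof.
have [E|/set0P[u Eu]] := eqVneq [set u | 0 < u /\ dilate u A x] set0.
  by rewrite /Yfun E sup0.
apply: (@le_trans _ _ u); first by case: Eu => /ltW.
by apply: ub_le_sup => //; exact: Yfun_has_ubound.
Qed.

Lemma measurable_Yfun (A : rare_set) : measurable_fun setT (Yfun A).
Proof.
apply: (measurability _ (measurable_realfun.RGenOInfty.measurableE R)).
move=> _ [_ [c ->] <-]; rewrite setTI; apply: open_measurable_rV.
have [c0|c0] := ltP c 0.
  rewrite (_ : _ @^-1` _ = setT); first exact: openT.
  apply/seteqP; split=> // x _ /=; rewrite in_itv/= andbT (lt_le_trans c0)//.
  exact: Yfun_ge0.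
rewrite (_ : _ @^-1` _ = \bigcup_(u in [set u | c < u]) dilate u A).
  apply: bigcup_open => u /= cu; apply: dilate_open; last exact: rare_open.
  exact: le_lt_trans cu.
apply/seteqP; split=> x /=; rewrite in_itv/= andbT.
  move=> cY; have [u [u0 xu] cu] : exists2 u, 0 < u /\ dilate u A x & c < u.
    apply: sup_gt => //; apply: contrapT => /set0P/negP/negPn/eqP E.
    by move: cY; rewrite /Yfun E sup0 ltNge c0.
  by exists u.
move=> [u /= cu xu]; apply: (lt_le_trans cu); apply: ub_le_sup.
  exact: Yfun_has_ubound.
by split=> //; exact: le_lt_trans cu.
Qed.

HB.instance Definition _ (A : rare_set) :=
  isMeasurableFun.Build _ _ _ _ (Yfun A) (measurable_Yfun A).

(* The distribution $F_A$ of $Y_A$ when the vector has distribution [F]. *)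
Definition law_Y (A : rare_set) (F : probability 'rV[R]_d R) :
  probability R R := distribution F (Yfun A).

(* The class $\mathcal S_A$, for distributions on the closed orthant. *)
Definition SA (A : rare_set) (F : probability 'rV[R]_d R) : Prop :=
  F orthant = 1%E /\ subexponential (law_Y A F).

End RareSets.

Section RandomSum.
Context (R : realType) (d : nat) disp (T : measurableType disp).

(* [X 0], [X 1], ... stand for $X^{(1)}, X^{(2)}, \ldots$ *)
Definition random_sum (X : nat -> {mfun T >-> 'rV[R]_d}) (N : {mfun T >-> nat})
  (w : T) : 'rV[R]_d := \sum_(i < N w) X i w.

Lemma measurable_random_sum X N : measurable_fun setT (random_sum X N).
Proof.
apply: measurable_rV => j _ B mB; rewrite setTI.
pose S n w := \sum_(i < n) X i w ord0 j.
have mS n : measurable_fun setT (S n).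
  apply: measurable_sum => i.
  exact: (measurableT_comp (@measurable_coord R d j) (measurable_funPT (X i))).
rewrite (_ : _ @^-1` B = \bigcup_n (N @^-1` [set n] `&` S n @^-1` B)).
  apply: bigcupT_measurable => n; apply: measurableI.
    by rewrite -[X in measurable X]setTI; exact: measurable_funP.
  by rewrite -[X in measurable X]setTI; exact: mS.
apply/seteqP; split=> [w /= Bw|w [n _ [/= <-]]].
  by exists (N w) => //; split=> //=; rewrite /S -summxE.
by rewrite /S -summxE.
Qed.

HB.instance Definition _ X N := isMeasurableFun.Build _ _ _ _
  (random_sum X N) (measurable_random_sum X N).

End RandomSum.

Section Independence.
Local Open Scope ereal_scope.
Context (R : realType) disp (T : measurableType disp) (P : probability T R).

Definition mutually_independent d' (E : measurableType d')
    (X : nat -> {RV P >-> E}) : Prop :=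
  forall (J : {fset nat}) (B : nat -> set E),
    (forall i, measurable (B i)) ->
    P (\bigcap_(i in [set` J]) X i @^-1` B i) =
    \prod_(i <- J) P (X i @^-1` B i).

(* The sigma-algebra generated by the whole sequence. *)
Definition sigma_generated d' (E : measurableType d')
    (X : nat -> {RV P >-> E}) : set (set T) :=
  <<s \bigcup_i [set X i @^-1` B | B in measurable] >>.

Definition independent_of_sequence d1 (E1 : measurableType d1)
    (N : {RV P >-> E1}) d2 (E2 : measurableType d2)
    (X : nat -> {RV P >-> E2}) : Prop :=
  forall B C, measurable B -> sigma_generated X C ->
    P (N @^-1` B `&` C) = P (N @^-1` B) * P C.

End Independence.

(* Main.v *)
Require Import Defs.
From HB Require Import structures.
From mathcomp Require Import all_boot all_order all_algebra.
From mathcomp Require Import finmap.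
From mathcomp Require Import all_classical all_reals all_analysis measurable_realfun.
From mathcomp Require Import ring lra.

Set Implicit Arguments.
Unset Strict Implicit.
Unset Printing Implicit Defensive.

Import Order.TTheory GRing.Theory Num.Theory.
Import numFieldNormedType.Exports.

Local Open Scope classical_set_scope.
Local Open Scope ring_scope.

(** For a rare set [A], the scale function [Yfun A] is subadditive, because the complement
    of [A] is convex, and increasing along the orthant, because [A] is. Moreover a vector
    lies in [dilate x A] exactly when its scale exceeds [x > 0] ([lt_Yfun]). The scale of
    a sum of [n] vectors is therefore squeezed between the maximum and the sum of their
    scales, which are independent with the subexponential law [V = law_Y A F]. Relative
    to [tail V], the tails of both bounds tend to [n]: the sum by subexponentiality, the
    maximum by a Bonferroni inequality. So the multivariate problem for a fixed number of
    vectors reduces to one on the line ([Yfun_sum_tail_ratio]).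

    To pass to a random number [N] of vectors, the ratio of tails is written as the
    expectation of the ratio for [n] vectors at [n = N w]. The Kesten bound
    ([kesten_bound]) dominates it by [K * (1 + eps) ^+ N w], integrable by assumption, and
    dominated convergence gives the limit ['E_P[N]] ([tail_ratio_random_sum]).

    This says that the law of the scale of the random sum has a tail equivalent to
    ['E_P[N] * tail V], with a positive constant. Subexponentiality is stable under such an
    equivalence ([subexponential_tail_ratio]), a consequence of the principle of a single
    big jump in the form of [tail_ratio_convolution]: if the tails of two laws have
    limits [c1] and [c2] relative to [tail V], their convolution has the limit
    [c1 + c2]. *)

(** * Real-valued probabilities *)

Section RealProbability.
Context d (T : measurableType d) (R : realType) (P : probability T R).
Implicit Types A B C : set T.

Lemma fine_prob_ge0 A : 0 <= fine (P A).
Proof. exact: fine_ge0. Qed.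

Lemma fine_prob_le1 A : measurable A -> fine (P A) <= 1.
Proof.
by move=> mA; rewrite -lee_fin fineK ?fin_num_measure// probability_le1.
Qed.

Lemma fine_prob_le A B : measurable A -> measurable B -> A `<=` B ->
  fine (P A) <= fine (P B).
Proof.
move=> mA mB AB; rewrite fine_le ?fin_num_measure//.
by rewrite le_measure ?inE.
Qed.

Lemma fine_probU A B : measurable A -> measurable B -> [disjoint A & B] ->
  fine (P (A `|` B)) = fine (P A) + fine (P B).
Proof.
move=> mA mB /disj_set2P AB.
by rewrite -fineD ?fin_num_measure// measureU.
Qed.

Lemma fine_probU_le A B : measurable A -> measurable B ->
  fine (P (A `|` B)) <= fine (P A) + fine (P B).
Proof.
move=> mA mB; rewrite -fineD ?fin_num_measure// fine_le ?fin_num_measure//.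
- exact: measurableU.
- by rewrite fin_numD !fin_num_measure.
- exact: measureU2.
Qed.

Lemma fine_probC A : measurable A -> fine (P (~` A)) = 1 - fine (P A).
Proof.
by move=> mA; rewrite probability_setC// fineB ?fin_num_measure.
Qed.

End RealProbability.

(** * Product laws and their tails *)

Section ProductTails.
Variable R : realType.
Implicit Types (mu nu V W : probability R R) (B C : set (R * R)).

Definition nonneg_law mu : Prop := mu `[0, +oo[%classic = 1%E.

(** The product measure with its structure of probability measure attached, so that
    lemmas on probabilities apply to it. *)
Definition prod_law mu nu : probability (R * R)%type R := (mu \x nu)%E.

Lemma tail_ge0 mu x : 0 <= tail mu x.
Proof. exact: fine_prob_ge0. Qed.

Lemma tail_le1 mu x : tail mu x <= 1.
Proof. exact: fine_prob_le1. Qed.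

Lemma tail_anti mu x y : x <= y -> tail mu y <= tail mu x.
Proof.
move=> xy; apply: fine_prob_le => //= z /=; rewrite !in_itv/= !andbT.
exact: le_lt_trans.
Qed.

Lemma fine_prob_setNyc mu x : fine (mu `]-oo, x]%classic) = 1 - tail mu x.
Proof. by rewrite -fine_probC// setCitvr. Qed.

Lemma tail_cvg0 mu : tail mu x @[x --> +oo] --> (0 : R).
Proof.
have h : fine (mu `]-oo, x]%classic) @[x --> +oo] --> (1 : R).
  apply: fine_cvg.
  pose I : {RV mu >-> R} := HB.pack idfun
    (@isMeasurableFun.Build _ _ R R idfun (@measurable_id _ R setT)).
  have := @cvg_cdfy1 _ _ _ mu I.
  by apply: cvg_trans.
rewrite (_ : tail mu = fun x => 1 - fine (mu `]-oo, x]%classic)); last first.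
  by apply/funext => x; rewrite fine_prob_setNyc subKr.
rewrite -[X in _ --> X](subrr (1 : R)).
by apply: cvgB => //; exact: cvg_cst.
Qed.

Lemma fine_prod_lawX mu nu (A B : set R) : measurable A -> measurable B ->
  fine (prod_law mu nu (A `*` B)) = fine (mu A) * fine (nu B).
Proof.
by move=> mA mB; rewrite /prod_law/= product_measure1E// fineM ?fin_num_measure.
Qed.

Lemma nonneg_law_neg mu : nonneg_law mu -> fine (mu `]-oo, 0[%classic) = 0.
Proof.
move=> nn; rewrite -[X in mu X]setCK setCitvl fine_probC//.
by rewrite [in X in fine X]nn/= subrr.
Qed.

(** Laws carried by the half-line do not see negative coordinates, so events may be
    compared on the positive quadrant only. *)
Lemma fine_prod_law_le mu nu B C : nonneg_law mu -> nonneg_law nu ->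
  measurable B -> measurable C ->
  (forall a b, 0 <= a -> 0 <= b -> B (a, b) -> C (a, b)) ->
  fine (prod_law mu nu B) <= fine (prod_law mu nu C).
Proof.
move=> nmu nnu mB mC BC.
pose D1 : set (R * R) := `]-oo, 0[%classic `*` setT.
pose D2 : set (R * R) := setT `*` `]-oo, 0[%classic.
have mD1 : measurable D1 by exact: measurableX.
have mD2 : measurable D2 by exact: measurableX.
apply: (@le_trans _ _ (fine (prod_law mu nu (C `|` (D1 `|` D2))))).
  apply: fine_prob_le => //; first by do 2 apply: measurableU => //.
  move=> [a b] Bab; have [a0|a0] := ltP a 0.
    by right; left; split; rewrite //= in_itv/=.
  have [b0|b0] := ltP b 0; first by right; right; split; rewrite //= in_itv/=.
  by left; exact: BC.
apply: (le_trans (fine_probU_le _ _ _)) => //; first exact: measurableU.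
rewrite gerDl; apply: (le_trans (fine_probU_le _ _ _)) => //.
by rewrite !fine_prod_lawX// !nonneg_law_neg// mul0r mulr0 addr0.
Qed.

Lemma measurable_sum_gt x : measurable [set z : R * R | x < z.1 + z.2].
Proof.
rewrite (_ : [set _ | _] = (fun z : R * R => z.1 + z.2) @^-1` `]x, +oo[%classic).
  by rewrite -[X in measurable X]setTI; exact: measurable_add.
by apply/seteqP; split=> z /=; rewrite in_itv/= andbT.
Qed.

Lemma tail_convolution mu nu x :
  tail (convolution mu nu) x = fine (prod_law mu nu [set z | x < z.1 + z.2]).
Proof.
rewrite /tail /= /convolution/= /pushforward/=; congr (fine (_ _)).
by apply/seteqP; split=> z /=; rewrite in_itv/= andbT.
Qed.

Lemma nonneg_law_convolution mu nu : nonneg_law mu -> nonneg_law nu ->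
  nonneg_law (convolution mu nu).
Proof.
move=> nmu nnu.
pose D : set R := `[0, +oo[%classic; have mD : measurable D by exact: measurable_itv.
apply/eqP; rewrite eq_le probability_le1//=.
apply: (@le_trans _ _ (prod_law mu nu (D `*` D))).
  have -> : prod_law mu nu (D `*` D) = (mu D * nu D)%E.
    by rewrite -(product_measure1E mu nu mD mD).
  by rewrite nmu nnu mule1.
apply: le_measure; rewrite ?inE//.
- exact: measurableX.
- by rewrite -[X in measurable X]setTI; exact: measurable_add.
- move=> [a b] []; rewrite /D /= !in_itv/= !andbT => a0 b0.
  exact: addr_ge0.
Qed.

(** By Tonelli the product law integrates the probabilities of sections. When these
    sections are half-lines starting at a nonnegative point, a domination of tails on the
    half-line is enough to replace one factor by another. *)
Lemma fine_prod_law_section_le1 mu mu' nu K B : 0 <= K ->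
  (forall r, 0 <= r -> tail mu r <= K * tail mu' r) -> measurable B ->
  (forall b, ysection B b = set0 \/
     exists2 r, 0 <= r & ysection B b = `]r, +oo[%classic) ->
  fine (prod_law mu nu B) <= K * fine (prod_law mu' nu B).
Proof.
move=> K0 h mB sB.
have E m : (prod_law m nu B = (m \x^ nu) B)%E.
  by apply: product_measure_unique => //= ? ? ? ?; rewrite product_measure2E.
rewrite -lee_fin EFinM !fineK ?fin_num_measure// !E /product_measure2.
rewrite -ge0_integralZl//; last exact: measurable_fun_ysection.
apply: ge0_le_integral => //.
- exact: measurable_fun_ysection.
- by apply: measurable_funeM; exact: measurable_fun_ysection.
move=> b _ /=; have [->|[r r0 ->]] := sB b; first by rewrite !measure0 mule0.
have := h _ r0; rewrite -lee_fin EFinM /tail !fineK ?fin_num_measure//.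
Qed.

Lemma fine_prod_law_section_le2 mu nu nu' K B : 0 <= K ->
  (forall r, 0 <= r -> tail nu r <= K * tail nu' r) -> measurable B ->
  (forall a, xsection B a = set0 \/
     exists2 r, 0 <= r & xsection B a = `]r, +oo[%classic) ->
  fine (prod_law mu nu B) <= K * fine (prod_law mu nu' B).
Proof.
move=> K0 h mB sB.
rewrite -lee_fin EFinM !fineK ?fin_num_measure//.
rewrite /prod_law/= /product_measure1.
rewrite -ge0_integralZl//; last exact: measurable_fun_xsection.
apply: ge0_le_integral => //.
- exact: measurable_fun_xsection.
- by apply: measurable_funeM; exact: measurable_fun_xsection.
move=> a _ /=; have [->|[r r0 ->]] := sB a; first by rewrite !measure0 mule0.
have := h _ r0; rewrite -lee_fin EFinM /tail !fineK ?fin_num_measure//.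
Qed.

(** The iterated convolution starts from the unit mass at 0; this removes that factor. *)
Lemma convolution_dirac V B : measurable B ->
  prod_law (convolution \d_(0 : R) V) V B = prod_law V V B.
Proof.
have E (C : set R) : measurable C -> convolution \d_(0 : R) V C = V C.
  move=> mC; rewrite /convolution /pushforward /product_measure1/=.
  set D := (X in xsection X).
  have mD : measurable D.
    by rewrite -[D]setTI; exact: measurable_add.
  rewrite integral_dirac//; last exact: measurable_fun_xsection.
  rewrite diracT mul1e/=; congr (V _); apply/seteqP; split=> b.
    by rewrite /xsection/= inE /D/= add0r.
  by move=> Cb; rewrite /xsection/= inE /D/= add0r.
move=> mB; apply: product_measure_unique => // C D mC mD.
by rewrite /prod_law/= product_measure1E// E.
Qed.

End ProductTails.

(** * Inequalities for the tail of a convolution *)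

Section ConvolutionInequalities.
Variable R : realType.
Implicit Types mu nu V W : probability R R.

(** The event that the sum is large although neither summand is small; it is the
    part of the tail of a convolution that subexponentiality makes negligible. *)
Definition both_exceed (M x : R) : set (R * R) :=
  [set z | [/\ M < z.1, M < z.2 & x < z.1 + z.2]].

Lemma measurable_both_exceed M x : measurable (both_exceed M x).
Proof.
rewrite (_ : both_exceed M x = (`]M, +oo[%classic `*` `]M, +oo[%classic) `&`
    [set z | x < z.1 + z.2]).
  by apply: measurableI; [exact: measurableX|exact: measurable_sum_gt].
apply/seteqP; split=> [[a b] []|[a b] [[]]] /=; rewrite !in_itv/= !andbT//.
Qed.

Lemma fine_prob_setT mu : fine (mu setT) = 1.
Proof. by rewrite probability_setT. Qed.

Lemma fine_prob_setoc mu M x : M <= x ->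
  fine (mu `]M, x]%classic) = tail mu M - tail mu x.
Proof.
move=> Mx; rewrite /tail.
have -> : `]M, +oo[%classic = `]M, x]%classic `|` `]x, +oo[%classic.
  apply/seteqP; split=> z /=; rewrite !in_itv/= !andbT.
    by move=> ->; case: (leP z x) => ?; [left|right].
  by case=> [/andP[]//|]; exact: le_lt_trans.
rewrite fine_probU ?addrK//; apply/disj_set2P/seteqP; split=> // z [] /=.
by rewrite !in_itv/= !andbT => /andP[_ zx]; rewrite ltNge zx.
Qed.

(** Apart from the case where both summands exceed [M], the sum exceeds [x] as soon as
    one summand does while the other stays below [M]; these events are disjoint. *)
Lemma tail_convolution_ge_both V M x : nonneg_law V -> 0 <= M <= x ->
  fine (prod_law V V (both_exceed M x)) + 2 * (tail V x * (1 - tail V M)) <=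
  tail (convolution V V) x.
Proof.
move=> nV /andP[M0 Mx]; rewrite tail_convolution.
pose A : set (R * R) := `]x, +oo[%classic `*` `]-oo, M]%classic.
pose B : set (R * R) := `]-oo, M]%classic `*` `]x, +oo[%classic.
have mA : measurable A by exact: measurableX.
have mB : measurable B by exact: measurableX.
have mC := measurable_both_exceed M x.
have <- : fine (prod_law V V (A `|` B)) = 2 * (tail V x * (1 - tail V M)).
  rewrite fine_probU//; last first.
    apply/disj_set2P/seteqP; split=> // -[a b] [[/= + _] [/= + _]].
    by rewrite !in_itv/= andbT => xa; rewrite leNgt (le_lt_trans Mx).
  by rewrite !fine_prod_lawX// fine_prob_setNyc /tail; ring.
rewrite -fine_probU//; last 2 first.
- exact: measurableU.
- apply/disj_set2P/seteqP; split=> // -[a b] [[/= Ma Mb _]].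
  by case=> -[/=]; rewrite !in_itv/= ?andbT leNgt ?Ma ?Mb.
apply: fine_prod_law_le => //.
- by do 2 apply: measurableU => //.
- exact: measurable_sum_gt.
move=> a b a0 b0 [[]//|[]] [] /=; rewrite !in_itv/= ?andbT => h1 h2.
  by rewrite (lt_le_trans h1)// lerDl.
by rewrite (lt_le_trans h2)// lerDr.
Qed.

(** Three disjoint ways to exceed [x]: the second summand alone does it, or it is at
    most [M] and the first one does it, or it lies in (M, x] and the first one exceeds
    [x - M]. The last term brings in the shifted tail, which is how long-tailedness will be
    derived. *)
Lemma tail_convolution_ge_shift V M x : nonneg_law V -> 0 <= M <= x ->
  tail V x + tail V x * (1 - tail V M) +
    tail V (x - M) * (tail V M - tail V x) <= tail (convolution V V) x.
Proof.
move=> nV /andP[M0 Mx]; rewrite tail_convolution.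
pose A : set (R * R) := setT `*` `]x, +oo[%classic.
pose B : set (R * R) := `]x, +oo[%classic `*` `]-oo, M]%classic.
pose C : set (R * R) := `](x - M), +oo[%classic `*` `]M, x]%classic.
have mA : measurable A by exact: measurableX.
have mB : measurable B by exact: measurableX.
have mC : measurable C by exact: measurableX.
have -> : tail V x + tail V x * (1 - tail V M) +
    tail V (x - M) * (tail V M - tail V x) = fine (prod_law V V ((A `|` B) `|` C)).
  rewrite fine_probU//; last 2 first.
  - exact: measurableU.
  - apply/disj_set2P/seteqP; split=> // -[a b] [+ [_ /=]].
    rewrite in_itv/= => + /andP[Mb bx].
    by case=> -[/= _]; rewrite in_itv/= ?andbT; apply/negP; rewrite -?leNgt// -ltNge.
  rewrite fine_probU//; last first.
    apply/disj_set2P/seteqP; split=> // -[a b] [[/= _ +] [/= _]].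
    by rewrite !in_itv/= andbT => xb; rewrite leNgt (le_lt_trans Mx).
  by rewrite !fine_prod_lawX// fine_prob_setT fine_prob_setNyc fine_prob_setoc// mul1r.
apply: fine_prod_law_le => //.
- by apply: measurableU => //; apply: measurableU.
- exact: measurable_sum_gt.
move=> a b a0 b0 [[]|] [] /=; rewrite ?in_itv/= ?andbT.
- by move=> _ h2; rewrite (lt_le_trans h2)// lerDr.
- by move=> h1 h2; rewrite (lt_le_trans h1)// lerDl.
- by move=> h1 /andP[h2 _]; rewrite -(subrK M x) ltrD.
Qed.

Lemma tail_convolution_le_split mu nu M x :
  tail (convolution mu nu) x <=
  tail mu (x - M) + tail nu (x - M) + fine (prod_law mu nu (both_exceed M x)).
Proof.
rewrite tail_convolution.
pose A : set (R * R) := `](x - M), +oo[%classic `*` setT.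
pose B : set (R * R) := setT `*` `](x - M), +oo[%classic.
have mA : measurable A by exact: measurableX.
have mB : measurable B by exact: measurableX.
have mC := measurable_both_exceed M x.
have mAB : measurable (A `|` B) by exact: measurableU.
apply: (@le_trans _ _ (fine (prod_law mu nu ((A `|` B) `|` both_exceed M x)))).
  apply: fine_prob_le.
  - exact: measurable_sum_gt.
  - exact: measurableU.
  move=> [a b] /= xab.
  have [bM|Mb] := leP b M.
    by left; left; split=> //=; rewrite in_itv/= andbT; lra.
  have [aM|Ma] := leP a M.
    by left; right; split=> //=; rewrite in_itv/= andbT; lra.
  by right.
apply: (le_trans (fine_probU_le _ _ _)) => //; rewrite lerD2r.
apply: (le_trans (fine_probU_le _ _ _)) => //.
by rewrite !fine_prod_lawX// !fine_prob_setT mulr1 mul1r.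
Qed.

Lemma tail_convolution_ge_max mu nu x : nonneg_law mu -> nonneg_law nu ->
  tail mu x + tail nu x - tail mu x * tail nu x <= tail (convolution mu nu) x.
Proof.
move=> nmu nnu; rewrite tail_convolution.
pose A : set (R * R) := `]x, +oo[%classic `*` setT.
pose B : set (R * R) := `]-oo, x]%classic `*` `]x, +oo[%classic.
have mA : measurable A by exact: measurableX.
have mB : measurable B by exact: measurableX.
have -> : tail mu x + tail nu x - tail mu x * tail nu x =
    fine (prod_law mu nu (A `|` B)).
  rewrite fine_probU//; last first.
    apply/disj_set2P/seteqP; split=> // -[a b] [[/= + _] [/= + _]].
    by rewrite !in_itv/= andbT leNgt => ->.
  by rewrite !fine_prod_lawX// fine_prob_setT fine_prob_setNyc /tail; ring.
apply: fine_prod_law_le => //; first exact: measurableU.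
  exact: measurable_sum_gt.
move=> a b a0 b0 [] [] /=; rewrite !in_itv/= ?andbT.
  by move=> h _; rewrite (lt_le_trans h)// lerDl.
by move=> _ h; rewrite (lt_le_trans h)// lerDr.
Qed.

(** The two factors are replaced by [V] one after the other: all sections of the event
    are empty or half-lines starting at or above [M]. *)
Lemma both_exceed_le mu nu V K L M x : 0 <= M -> 0 <= K -> 0 <= L ->
  (forall r, 0 <= r -> tail mu r <= K * tail V r) ->
  (forall r, 0 <= r -> tail nu r <= L * tail V r) ->
  fine (prod_law mu nu (both_exceed M x)) <=
  K * L * fine (prod_law V V (both_exceed M x)).
Proof.
move=> M0 K0 L0 muV nuV; have mC := measurable_both_exceed M x.
apply: (@le_trans _ _ (K * fine (prod_law V nu (both_exceed M x)))).
  apply: fine_prod_law_section_le1 => // b; have [bM|Mb] := leP b M.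
    left; apply/seteqP; split=> // a; rewrite /ysection/= inE => -[_ /= + _].
    by rewrite ltNge bM.
  right; exists (Num.max M (x - b)); first by rewrite le_max M0.
  apply/seteqP; split=> a; rewrite /ysection/= inE /both_exceed/= in_itv/= andbT.
    by move=> [Ma _ xab]; rewrite gt_max Ma/=; lra.
  by rewrite gt_max => /andP[Ma xab]; split=> //; lra.
rewrite -mulrA ler_wpM2l//.
apply: fine_prod_law_section_le2 => // a; have [aM|Ma] := leP a M.
  left; apply/seteqP; split=> // b; rewrite /xsection/= inE => -[/= + _ _].
  by rewrite ltNge aM.
right; exists (Num.max M (x - a)); first by rewrite le_max M0.
apply/seteqP; split=> b; rewrite /xsection/= inE /both_exceed/= in_itv/= andbT.
  by move=> [_ Mb xab]; rewrite gt_max Mb/=; lra.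
by rewrite gt_max => /andP[Mb xab]; split=> //; lra.
Qed.

(** The induction step of the Kesten bound. Either the last summand alone exceeds [x],
    or, given its value in [0, x], the other one must exceed a nonnegative level, where its
    tail is dominated by that of [V]. *)
Lemma tail_convolution_le_step W V a x : nonneg_law V -> 0 <= a -> 0 <= x ->
  (forall r, 0 <= r -> tail W r <= a * tail V r) ->
  tail (convolution W V) x <=
  tail V x + a * (tail (convolution V V) x - tail V x).
Proof.
move=> nV a0 x0 WV; rewrite !tail_convolution.
pose A : set (R * R) := setT `*` `]x, +oo[%classic.
pose B : set (R * R) := (setT `*` `]-oo, x]%classic) `&` [set z | x < z.1 + z.2].
have mS := measurable_sum_gt x.
have mA : measurable A by exact: measurableX.
have mB : measurable B by apply: measurableI => //; exact: measurableX.
have PA U : fine (prod_law U V A) = tail V x.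
  by rewrite fine_prod_lawX// fine_prob_setT mul1r.
apply: (@le_trans _ _ (fine (prod_law W V (A `|` B)))).
  apply: fine_prob_le => //; first exact: measurableU.
  move=> [y b] /= h; have [bx|xb] := leP b x.
    by right; split=> //; split=> //=; rewrite in_itv/=.
  by left; split=> //=; rewrite in_itv/= andbT.
apply: (le_trans (fine_probU_le _ _ _)) => //; rewrite PA lerD2l.
apply: (@le_trans _ _ (a * fine (prod_law V V B))).
  apply: fine_prod_law_section_le1 => // b; have [bx|xb] := leP b x; last first.
    left; apply/seteqP; split=> // y; rewrite /ysection/= inE => -[[_ /=]].
    by rewrite in_itv/= leNgt xb.
  right; exists (x - b); first by rewrite subr_ge0.
  apply/seteqP; split=> y; rewrite /ysection/= inE /B/= !in_itv/= andbT.
    by move=> [_ h]; lra.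
  by move=> h; split; [split|lra].
rewrite ler_wpM2l// lerBrDr -[X in _ + X](PA V) -fine_probU//; last first.
  apply/disj_set2P/seteqP; split=> // -[y b] [[[_ /= +] _] [_ /=]].
  by rewrite !in_itv/= andbT leNgt => /negP.
apply: fine_prod_law_le => //; first exact: measurableU.
move=> y b y0 b0 [[]//|[_ /=]]; rewrite in_itv/= andbT => h.
by rewrite (lt_le_trans h)// lerDr.
Qed.

End ConvolutionInequalities.

(** * Subexponential laws: closure and the Kesten bound *)

Section TailAsymptotics.
Variable R : realType.
Implicit Types G H V W : probability R R.

(** Subexponentiality for two summands, from which long-tailedness, closure under
    convolution and the Kesten bound all follow. *)
Definition doubling_tail V : Prop :=
  [/\ nonneg_law V, forall x, 0 <= x -> 0 < tail V x &
    tail (convolution V V) x / tail V x @[x --> +oo] --> (2 : R)].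

Definition tail_ratio H V (c : R) : Prop :=
  tail H x / tail V x @[x --> +oo] --> c.

Lemma near_eq_cvg_pinfty (f g : R -> R) (l : R) :
  (\forall x \near +oo, f x = g x) ->
  f x @[x --> +oo] --> l -> g x @[x --> +oo] --> l.
Proof. by move=> fg; apply: cvg_trans; exact: near_eq_cvg. Qed.

Lemma subexponential_doubling V : subexponential V -> doubling_tail V.
Proof.
move=> [nV V0 /(_ 2 isT) V2]; split=> //.
apply: near_eq_cvg_pinfty V2; near=> x; congr (_ / _).
rewrite !tail_convolution/= convolution_dirac//; exact: measurable_sum_gt.
Unshelve. all: by end_near. Qed.

Lemma near_pinfty_ge (a : R) : \forall x \near +oo, a <= x.
Proof. exact: nbhs_pinfty_ge (num_real _). Qed.

Lemma near_tail_lt V (e : R) : 0 < e -> \forall x \near +oo, tail V x < e.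
Proof. by move=> e0; apply: (cvgr_lt 0) => //; exact: tail_cvg0. Qed.

(** Subexponential laws are long-tailed: in [tail_convolution_ge_shift] the first two
    terms already account for all of the limit 2 but a fraction [tail V M], and the third one
    is asymptotically [tail V M] times the ratio in question. *)
Lemma tail_long V M : doubling_tail V -> 0 <= M ->
  tail V (x - M) / tail V x @[x --> +oo] --> (1 : R).
Proof.
move=> [nV V0 V2] M0; set t := tail V M; have t0 : 0 < t by exact: V0.
pose h x := (tail (convolution V V) x / tail V x - 1 - (1 - t)) /
  (t - tail V x).
have hl : h x @[x --> +oo] --> (1 : R).
  have -> : (1 : R) = (2 - 1 - (1 - t)) / (t - 0) by field; exact: lt0r_neq0.
  rewrite /h; apply: cvgM.
    by apply: cvgB; [apply: cvgB => //|]; exact: cvg_cst.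
  apply: cvgV; first by rewrite subr0 gt_eqF.
  by apply: cvgB; [exact: cvg_cst|exact: tail_cvg0].
apply: squeeze_cvgr; last exact: hl; last exact: (cvg_cst (1 : R)).
near=> x.
have x0 : 0 <= x by near: x; exact: near_pinfty_ge.
have Mx : M <= x by near: x; exact: near_pinfty_ge.
have xt : tail V x < t by near: x; exact: near_tail_lt.
have Vx := V0 _ x0.
apply/andP; split; first by rewrite ler_pdivlMr// mul1r tail_anti// gerBl.
rewrite /h ler_pdivlMr ?subr_gt0//.
have := @tail_convolution_ge_shift _ V M x nV; rewrite M0 Mx => /(_ isT).
rewrite -/t -(ler_pM2r (x := (tail V x)^-1)) ?invr_gt0// => k.
rewrite lerBrDr lerBrDr; apply: le_trans k.
rewrite le_eqVlt; apply/orP; left; apply/eqP; field; exact: lt0r_neq0.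
Unshelve. all: by end_near. Qed.

Lemma tail_ratio_shift H V c M : doubling_tail V -> 0 <= M ->
  tail_ratio H V c -> tail H (x - M) / tail V x @[x --> +oo] --> c.
Proof.
move=> dV M0 HV; have [_ V0 _] := dV.
have HM : tail H (x - M) / tail V (x - M) @[x --> +oo] --> c.
  by apply: (cvg_comp (fun x => x - M) (fun x => tail H x / tail V x)) HV;
    exact: cvg_addrr.
have h : tail H (x - M) / tail V (x - M) * (tail V (x - M) / tail V x)
    @[x --> +oo] --> c * 1 by apply: cvgM => //; exact: tail_long.
rewrite mulr1 in h.
apply: near_eq_cvg_pinfty h; near=> x => /=.
have xM0 : 0 <= x - M by rewrite subr_ge0; near: x; exact: near_pinfty_ge.
by rewrite mulrA divfK// gt_eqF// V0.
Unshelve. all: by end_near. Qed.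

(** Beyond some level the ratio is close to its limit; below that level the tail of
    [V] is bounded away from 0. *)
Lemma tail_ratio_dominated H V c : doubling_tail V -> tail_ratio H V c ->
  exists2 K, 0 <= K & forall r, 0 <= r -> tail H r <= K * tail V r.
Proof.
move=> [_ V0 _] HV.
have [T [Tr HT]] : \forall x \near +oo, tail H x / tail V x < c + 1.
  by apply: (cvgr_lt c) => //; rewrite ltrDl.
(* [T] may be negative, and [HT] only holds strictly beyond it. *)
pose T' := Num.max 0 (T + 1); have T'0 : 0 <= T' by rewrite le_max lexx.
have VT := V0 _ T'0.
exists (`|c + 1| + (tail V T')^-1).
  by rewrite addr_ge0// invr_ge0 ltW.
move=> r r0; have Vr := V0 _ r0; rewrite mulrDl.
have [rT|Tr'] := leP r T'.
  rewrite (le_trans (tail_le1 _ _))//.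
  apply: (@le_trans _ _ ((tail V T')^-1 * tail V r)).
    by rewrite ler_pdivlMl// mulr1 tail_anti.
  by rewrite lerDr mulr_ge0// tail_ge0.
have : tail H r / tail V r < c + 1.
  by apply: HT; rewrite (lt_trans _ Tr')// /T' lt_max ltrDl ltr01 orbT.
rewrite ltr_pdivrMr// => /ltW k; apply: (le_trans k).
apply: (@le_trans _ _ (`|c + 1| * tail V r)).
  by rewrite ler_wpM2r ?tail_ge0// ler_norm.
by rewrite lerDl mulr_ge0 ?tail_ge0// invr_ge0 tail_ge0.
Qed.

(** The principle of a single big jump. The lower bound is the probability that the
    larger summand exceeds [x]. For the upper bound, either one of the summands exceeds
    [x - M], which costs the same as exceeding [x], or both exceed [M]; the latter event is
    dominated by the same event for [V], of relative size at most [2 * tail V M] in the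
    limit. *)
Lemma tail_ratio_convolution H1 H2 V c1 c2 : doubling_tail V ->
  nonneg_law H1 -> nonneg_law H2 -> tail_ratio H1 V c1 -> tail_ratio H2 V c2 ->
  tail_ratio (convolution H1 H2) V (c1 + c2).
Proof.
move=> dV n1 n2 r1 r2; have [nV V0 V2] := dV.
have [K K0 HK] := tail_ratio_dominated dV r1.
have [L L0 HL] := tail_ratio_dominated dV r2.
apply/cvgrPdist_le => e e0.
(* [M] makes the contribution of two large summands at most [e / 2]. *)
have [M [M0 KLM]] : exists M, 0 <= M /\ K * L * (2 * tail V M) <= e / 2.
  have d0 : 0 < e / (4 * (K * L + 1)).
    by rewrite divr_gt0// mulr_gt0// ltr_wpDl// mulr_ge0.
  have [M [M0 Md]] : exists M, 0 <= M /\ tail V M < e / (4 * (K * L + 1)).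
    near (@pinfty_nbhs R) => M; exists M; split.
      by near: M; exact: near_pinfty_ge.
    by near: M; exact: near_tail_lt.
  exists M; split=> //.
  have KL : 0 <= K * L by rewrite mulr_ge0.
  move: Md; rewrite ltr_pdivlMr; last by rewrite mulr_gt0// ltr_wpDl.
  have := tail_ge0 V M; nra.
pose u x := tail H1 (x - M) / tail V x + tail H2 (x - M) / tail V x +
  K * L * (tail (convolution V V) x / tail V x - 2 * (1 - tail V M)).
have ul : u x @[x --> +oo] --> c1 + c2 + K * L * (2 - 2 * (1 - tail V M)).
  rewrite /u; apply: cvgD; first by apply: cvgD; exact: tail_ratio_shift.
  by apply: cvgM; [exact: cvg_cst|apply: cvgB => //; exact: cvg_cst].
pose l x := tail H1 x / tail V x + tail H2 x / tail V x -
  tail H1 x * (tail H2 x / tail V x).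
have ll : l x @[x --> +oo] --> c1 + c2.
  rewrite -[X in _ --> X]subr0 -(mul0r c2).
  by rewrite /l; apply: cvgB; [exact: cvgD|apply: cvgM => //; exact: tail_cvg0].
near=> x.
have x0 : 0 <= x by near: x; exact: near_pinfty_ge.
have Mx : M <= x by near: x; exact: near_pinfty_ge.
have Vx := V0 _ x0.
have lx : c1 + c2 - e < l x.
  by near: x; apply: (cvgr_gt (c1 + c2)) => //; rewrite gtrBl.
have ux : u x < c1 + c2 + e.
  near: x; apply: (cvgr_lt (c1 + c2 + K * L * (2 - 2 * (1 - tail V M)))) => //.
  rewrite ltrD2l (le_lt_trans (y := e / 2))//; last first.
    by rewrite ltr_pdivrMr// ltr_pMr// ltr1n.
  by rewrite (_ : 2 - _ = 2 * tail V M)//; ring.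
rewrite ler_distlC; apply/andP; split.
  apply: (le_trans (ltW lx)); rewrite ler_pdivlMr//.
  apply: le_trans (tail_convolution_ge_max x n1 n2).
  rewrite le_eqVlt; apply/orP; left; apply/eqP; rewrite /l; field.
  exact: lt0r_neq0.
apply: le_trans (ltW ux); rewrite ler_pdivrMr//.
apply: (le_trans (tail_convolution_le_split _ _ M _)).
have b := both_exceed_le x M0 K0 L0 HK HL.
have := @tail_convolution_ge_both _ V M x nV; rewrite M0 Mx => /(_ isT) g.
have {}b : fine (prod_law H1 H2 (both_exceed M x)) <=
    K * L * (tail (convolution V V) x - 2 * (tail V x * (1 - tail V M))).
  by apply: (le_trans b); rewrite ler_wpM2l ?mulr_ge0// lerBrDr.
apply: (le_trans (lerD (lexx _) b)).
rewrite le_eqVlt; apply/orP; left; apply/eqP; rewrite /u; field.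
exact: lt0r_neq0.
Unshelve. all: by end_near. Qed.

Lemma tail_dirac0 x : 0 <= x -> tail \d_(0 : R) x = 0.
Proof.
move=> x0; have -> : tail \d_(0 : R) x = fine (\d_(0 : R) `]x, +oo[%classic) by [].
by rewrite diracE memNset//= in_itv/= andbT; apply/negP; rewrite -leNgt.
Qed.

Lemma nonneg_law_dirac0 : nonneg_law (\d_(0 : R) : probability R R).
Proof.
rewrite /nonneg_law; have -> : (\d_(0 : R) : probability R R) `[0, +oo[%classic =
  \d_(0 : R) `[0, +oo[%classic by [].
by rewrite diracE mem_set//= in_itv/= lexx.
Qed.

Lemma nonneg_law_convolution_power V n : nonneg_law V ->
  nonneg_law (convolution_power V n).
Proof.
move=> nV; elim: n => [|n IH]/=; first exact: nonneg_law_dirac0.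
exact: nonneg_law_convolution.
Qed.

Lemma tail_ratio_convolution_power H V c n : doubling_tail V -> nonneg_law H ->
  tail_ratio H V c -> tail_ratio (convolution_power H n) V (n%:R * c).
Proof.
move=> dV nH HV; elim: n => [|n IH].
  rewrite mul0r; apply: near_eq_cvg_pinfty (cvg_cst (0 : R)); near=> x => /=.
  by rewrite tail_dirac0 ?mul0r//; near: x; exact: near_pinfty_ge.
rewrite -natr1 mulrDl mul1r; apply: tail_ratio_convolution => //.
exact: nonneg_law_convolution_power.
Unshelve. all: by end_near. Qed.

Lemma tail_ratio_refl V : doubling_tail V -> tail_ratio V V 1.
Proof.
move=> [_ V0 _]; apply: near_eq_cvg_pinfty (cvg_cst (1 : R)); near=> x.
have x0 : 0 <= x by near: x; exact: near_pinfty_ge.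
by rewrite /= divff// gt_eqF// V0.
Unshelve. all: by end_near. Qed.

(** The class of subexponential laws is closed under tail equivalence up to a constant. *)
Lemma subexponential_tail_ratio G V c : doubling_tail V -> nonneg_law G ->
  0 < c -> tail_ratio G V c -> subexponential G.
Proof.
move=> dV nG c0 GV; have [_ V0 _] := dV.
have G0 x : 0 <= x -> 0 < tail G x.
  move=> x0; near (@pinfty_nbhs R) => y.
  have xy : x <= y by near: y; exact: near_pinfty_ge.
  have : 0 < tail G y / tail V y by near: y; apply: (cvgr_gt c).
  rewrite pmulr_lgt0 ?invr_gt0 ?V0 ?(le_trans x0)// => /lt_le_trans; apply.
  exact: tail_anti.
split=> // n _.
have h : tail (convolution_power G n) x / tail V x * (tail G x / tail V x)^-1
    @[x --> +oo] --> n%:R * c * c^-1.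
  apply: cvgM; first exact: tail_ratio_convolution_power.
  by apply: cvgV => //; exact: lt0r_neq0.
rewrite mulfK ?gt_eqF// in h; apply: near_eq_cvg_pinfty h; near=> x => /=.
have x0 : 0 <= x by near: x; exact: near_pinfty_ge.
by rewrite invf_div mulrA divfK// gt_eqF// V0.
Unshelve. all: by end_near. Qed.

(** If [b n] bounds the ratio of tails for [n] summands, [tail_convolution_le_step]
    shows that [c + (1 + eps) * b n] does so for [n + 1]: beyond some level the factor
    is the tail ratio for two summands minus 1, which is at most [1 + eps], and below that
    level [c] absorbs everything. *)
Lemma kesten_bound V (eps : R) : doubling_tail V -> 0 < eps ->
  exists2 K, 0 <= K & forall n x, 0 <= x ->
    tail (convolution_power V n) x <= K * (1 + eps) ^+ n * tail V x.
Proof.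
move=> [nV V0 V2] e0.
have [T [Tr HT]] : \forall x \near +oo,
    tail (convolution V V) x / tail V x < 2 + eps.
  by apply: (cvgr_lt 2) => //; rewrite ltrDl.
pose T' := Num.max 0 (T + 1); have T'0 : 0 <= T' by rewrite le_max lexx.
have VT := V0 _ T'0.
pose c := 1 + (tail V T')^-1.
have VT1 : 0 <= (tail V T')^-1 by rewrite invr_ge0 ltW.
have c0 : 0 <= c by rewrite addr_ge0.
(* The solution of [b n.+1 = c + (1 + eps) * b n] with [b 0 = 0]. *)
pose b n := c / eps * ((1 + eps) ^+ n - 1).
have b0 n : 0 <= b n.
  rewrite mulr_ge0 ?divr_ge0 ?(ltW e0)// subr_ge0 exprn_ege1//.
  by rewrite lerDl ltW.
have bS n : b n.+1 = c + (1 + eps) * b n.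
  by rewrite /b exprS; field; exact: lt0r_neq0.
have H n x : 0 <= x -> tail (convolution_power V n) x <= b n * tail V x.
  elim: n x => [|n IH] x x0; first by rewrite tail_dirac0// mulr_ge0// tail_ge0.
  have Vx := V0 _ x0; rewrite bS mulrDl.
  have [xT|Tx] := leP x T'.
    apply: (@le_trans _ _ (c * tail V x)); last first.
      rewrite lerDl; apply: mulr_ge0; last exact: tail_ge0.
      by apply: mulr_ge0 => //; rewrite addr_ge0// ltW.
    rewrite (le_trans (tail_le1 _ _))// /c mulrDl mul1r.
    apply: (@le_trans _ _ ((tail V T')^-1 * tail V x)).
      by rewrite ler_pdivlMl// mulr1 tail_anti.
    by rewrite lerDr tail_ge0.
  have /ltW : tail (convolution V V) x / tail V x < 2 + eps.
    by apply: HT; rewrite (lt_trans _ Tx)// /T' lt_max ltrDl ltr01 orbT.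
  rewrite ler_pdivrMr// => k.
  apply: (le_trans (tail_convolution_le_step nV (b0 n) x0 IH)).
  apply: lerD; first by rewrite ler_peMl ?tail_ge0// lerDl.
  rewrite -[leRHS]mulrA [leRHS]mulrCA; apply: ler_wpM2l => //; lra.
exists (c / eps); first by rewrite divr_ge0// ltW.
move=> n x x0; apply: (le_trans (H _ _ x0)).
rewrite ler_wpM2r ?tail_ge0// ler_wpM2l ?divr_ge0 ?(ltW e0)//.
by rewrite gerBl.
Qed.

End TailAsymptotics.

(** * Geometry of the scale function of a rare set *)

Section Geometry.
Variables (R : realType) (d : nat).
Implicit Types (A : rare_set R d) (x y z : 'rV[R]_d) (u v t : R).

Lemma dilateE (A : set 'rV[R]_d) u x : 0 < u ->
  dilate u A x <-> A (u^-1 *: x).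
Proof.
move=> u0; split=> [[a Aa <-]|Ax].
  by rewrite scalerA mulVf ?gt_eqF// scale1r.
by exists (u^-1 *: x) => //; rewrite scalerA mulfV ?gt_eqF// scale1r.
Qed.

Lemma rare_setN0 A : ~ rare_car A 0.
Proof. by move=> A0; apply: (@rare_not0 _ _ A); exact: subset_closure. Qed.

Lemma rare_setN_conv A x y t : 0 <= t <= 1 -> ~ rare_car A x -> ~ rare_car A y ->
  ~ rare_car A (t *: x + (1 - t) *: y).
Proof.
move=> t01 Ax Ay; have /andP[t0 t1] := t01.
have := @rare_convexC _ _ A x y (Itv01 t0 t1).
by rewrite !inE; exact.
Qed.

(** The complement of [A] is star-shaped about 0, so the set of scales [u] with [z] in
    [dilate u A] is an interval starting at 0, and it contains no largest element because [A]
    is open. *)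
Lemma lt_Yfun A u z : 0 < u -> u < Yfun A z <-> dilate u A z.
Proof.
move=> u0; rewrite dilateE//; split=> [uY|Az].
  have [v [v0 Av] uv] : exists2 v, 0 < v /\ dilate v A z & u < v.
    apply: sup_gt => //; apply: contrapT => /set0P/negP/negPn/eqP E.
    by move: uY; rewrite /Yfun E sup0 ltNge ltW.
  move/dilateE : Av => /(_ v0) Av; apply: contrapT => Nz; move: Av.
  have -> : v^-1 *: z = (u / v) *: (u^-1 *: z) + (1 - u / v) *: 0.
    by rewrite scaler0 addr0 scalerA mulrAC divff ?mul1r// gt_eqF.
  apply: rare_setN_conv => //; last exact: rare_setN0.
  by rewrite divr_ge0 ?(ltW u0) ?(ltW v0)// ler_pdivrMr// mul1r ltW.
have : nbhs (u^-1 : R) [set s | rare_car A (s *: z)].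
  have c : continuous (fun s : R => s *: z) by exact: scalel_continuous.
  by apply: c; apply: open_nbhs_nbhs; split=> //; exact: rare_open.
move=> /nbhs_ballP[e /= e0 he].
have iu : 0 < u^-1 by rewrite invr_gt0.
(* A scale slightly larger than [u], whose inverse [s] stays positive and within [e]
   of that of [u]. *)
pose s := u^-1 - Num.min (e / 2) (u^-1 / 2).
have m0 : 0 < Num.min (e / 2) (u^-1 / 2) by rewrite lt_min !divr_gt0.
have s0 : 0 < s.
  have : Num.min (e / 2) (u^-1 / 2) <= u^-1 / 2 by rewrite ge_min lexx orbT.
  by rewrite /s; lra.
have su : s < u^-1 by rewrite /s gtrBl.
have As : rare_car A (s *: z).
  apply: he; rewrite /ball/= /s opprB addrC subrK gtr0_norm//.
  by rewrite gt_min; apply/orP; left; lra.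
have us : u < s^-1 by rewrite -[u]invrK ltf_pV2.
apply: (lt_le_trans us); apply: ub_le_sup; first exact: Yfun_has_ubound.
have is0 : 0 < s^-1 by rewrite invr_gt0.
by split=> //; apply/dilateE => //; rewrite invrK.
Qed.

Lemma Yfun0 A : Yfun A 0 = 0.
Proof.
apply/eqP; rewrite eq_le Yfun_ge0 andbT leNgt; apply/negP => Y0.
have h0 : 0 < Yfun A 0 / 2 by rewrite divr_gt0.
have /(lt_Yfun _ _ h0) : Yfun A 0 / 2 < Yfun A 0.
  by rewrite ltr_pdivrMr// ltr_pMr// ltr1n.
by move/(dilateE _ _ h0); rewrite scaler0; exact: rare_setN0.
Qed.

(** If [x] is outside [u A] and [y] outside [v A], then [(x + y) / (u + v)] is a convex
    combination of [x / u] and [y / v], hence lies in the convex complement of [A]. *)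
Lemma Yfun_subadditive A x y : Yfun A (x + y) <= Yfun A x + Yfun A y.
Proof.
apply/ler_addgt0Pr => e e0.
pose u := Yfun A x + e / 2; pose v := Yfun A y + e / 2.
have u0 : 0 < u by rewrite ltr_wpDl ?divr_gt0// Yfun_ge0.
have v0 : 0 < v by rewrite ltr_wpDl ?divr_gt0// Yfun_ge0.
have uv0 : 0 < u + v by rewrite addr_gt0.
have -> : Yfun A x + Yfun A y + e = u + v by rewrite /u /v; field.
rewrite leNgt; apply/negP => /(lt_Yfun _ _ uv0)/(dilateE _ _ uv0).
have -> : (u + v)^-1 *: (x + y) =
    (u / (u + v)) *: (u^-1 *: x) + (1 - u / (u + v)) *: (v^-1 *: y).
  rewrite !scalerA scalerDr; congr (_ *: _ + _ *: _); field;
    by rewrite ?lt0r_neq0.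
apply: rare_setN_conv.
- by rewrite divr_ge0 ?(ltW u0) ?(ltW uv0)// ler_pdivrMr// mul1r lerDl ltW.
- move=> /(dilateE _ _ u0)/(lt_Yfun _ _ u0); apply/negP.
  by rewrite -leNgt lerDl divr_ge0// ltW.
- move=> /(dilateE _ _ v0)/(lt_Yfun _ _ v0); apply/negP.
  by rewrite -leNgt lerDl divr_ge0// ltW.
Qed.

Lemma Yfun_increasing A x y : orthant y -> Yfun A x <= Yfun A (x + y).
Proof.
move=> oy; rewrite leNgt; apply/negP => h.
pose c := (Yfun A x + Yfun A (x + y)) / 2.
have c0 : 0 < c by rewrite /c; have := Yfun_ge0 A (x + y); lra.
have /(lt_Yfun _ _ c0)/(dilateE _ _ c0) Ac : c < Yfun A x by rewrite /c; lra.
suff : c < Yfun A (x + y) by rewrite /c; lra.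
apply/(lt_Yfun _ _ c0)/(dilateE _ _ c0); rewrite scalerDr.
apply: rare_increasing => // j; rewrite mxE mulr_ge0//.
by rewrite invr_ge0 ltW.
Qed.

Lemma Yfun_sum_le A n (f : 'I_n -> 'rV[R]_d) :
  Yfun A (\sum_(i < n) f i) <= \sum_(i < n) Yfun A (f i).
Proof.
elim/big_ind2 : _ => [|x1 a1 x2 a2 h1 h2|//]; first by rewrite Yfun0.
by apply: (le_trans (Yfun_subadditive _ _ _)); exact: lerD.
Qed.

Lemma orthant_sum n (P : pred 'I_n) (f : 'I_n -> 'rV[R]_d) :
  (forall i, orthant (f i)) -> orthant (\sum_(i < n | P i) f i).
Proof. by move=> of_ j; rewrite summxE; apply: sumr_ge0 => i _; exact: of_. Qed.

Lemma Yfun_le_sum A n (f : 'I_n -> 'rV[R]_d) i :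
  (forall i, orthant (f i)) -> Yfun A (f i) <= Yfun A (\sum_(i < n) f i).
Proof.
by move=> of_; rewrite (bigD1 i)//=; apply: Yfun_increasing; exact: orthant_sum.
Qed.

End Geometry.

(** * Laws of sums of independent variables *)

Section IndependentSums.
Context (R : realType) d (T : measurableType d) (P : probability T R).
Variables (V : probability R R) (Z : nat -> T -> R).
Hypothesis mZ : forall i, measurable_fun setT (Z i).

(** Independence of the first [n] variables, of common law [V], jointly with the event
    [E]. Carrying [E] along makes the induction of [partial_sum_law] possible. *)
Definition product_rule n (E : set T) : Prop := forall B : nat -> set R,
  (forall i, measurable (B i)) ->
  P ([set w | forall i, (i < n)%N -> B i (Z i w)] `&` E) =
  (\prod_(i < n) V (B i) * P E)%E.

Lemma measurable_partial_sum n : measurable_fun setT (fun w => \sum_(i < n) Z i w).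
Proof. by apply: measurable_sum => i; exact: mZ. Qed.

Lemma measurable_preimage (f : T -> R) (C : set R) :
  measurable_fun setT f -> measurable C -> measurable [set w | C (f w)].
Proof. by move=> mf mC; rewrite -[X in measurable X]setTI; exact: mf. Qed.

(** In the induction step the constraint on the last variable is absorbed into [E], so
    that the pair formed by the sum of the first [n] variables and the last one factorizes on
    rectangles, and thus has a product law. *)
Lemma partial_sum_law n E C : measurable E -> product_rule n E -> measurable C ->
  P ([set w | C (\sum_(i < n) Z i w)] `&` E) =
  (convolution_power V n C * P E)%E.
Proof.
elim: n E C => [|n IH] E C mE rE mC.
  transitivity (\d_(0%R : R) C * P E)%E; last by [].
  rewrite diracE; have [C0|C0] := boolP ((0 : R) \in C).
    rewrite mul1e; congr (P _); apply/seteqP; split=> [w []//|w Ew].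
    by split=> //=; rewrite big_ord0; exact/set_mem.
  rewrite mul0e -(measure0 P); congr (P _); apply/seteqP; split=> // w [/=].
  by rewrite big_ord0 => /mem_set h; rewrite h in C0.
have rn D : measurable D -> P ([set w | D (Z n w)] `&` E) = (V D * P E)%E.
  move=> mD; have mB i : measurable (if i == n then D else setT : set R).
    by case: ifP.
  have := rE _ mB.
  rewrite big_ord_recr/= eqxx big1 ?mul1e; last first.
    by move=> i _; rewrite ltn_eqF ?probability_setT.
  move=> <-; congr (P (_ `&` _)); apply/seteqP; split=> w /= h.
    by move=> i; case: ifP => // /eqP ->.
  by have := h n (ltnSn n); rewrite eqxx.
have rIH D : measurable D -> product_rule n ([set w | D (Z n w)] `&` E).
  move=> mD B mB; have mB' i : measurable (if i == n then D else B i).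
    by case: ifP.
  have := rE _ mB'.
  rewrite big_ord_recr/= eqxx rn// muleA => h.
  rewrite (eq_bigr (fun i : 'I_n => V (B i))) in h; last first.
    by move=> i _; rewrite ltn_eqF.
  rewrite -h setIA; congr (P (_ `&` _)); apply/seteqP; split=> w /=.
    move=> [h1 h2] i; rewrite ltnS leq_eqVlt => /orP[/eqP ->|lin].
      by rewrite eqxx.
    by rewrite ltn_eqF//; exact: h1.
  move=> h1; split=> [i lin|]; last by have := h1 n (ltnSn n); rewrite eqxx.
  by have := h1 i (ltnW lin); rewrite ltn_eqF.
have [PE0|PE0] := eqVneq (P E) 0%E.
  rewrite PE0 mule0; apply/eqP; rewrite eq_le measure_ge0 andbT -PE0.
  apply: le_measure; rewrite ?inE//; apply: measurableI => //.
  by apply: measurable_preimage => //; exact: measurable_partial_sum.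
have p0 : 0 < fine (P E) 
  by rewrite fine_gt0// lt0e PE0 measure_ge0/= -ge0_fin_numE ?fin_num_measure.
pose f w := (\sum_(i < n) Z i w, Z n w).
have mf : measurable_fun setT f.
  by apply: measurable_fun_pair => //; exact: measurable_partial_sum.
pose k : {nonneg R} := NngNum (ltW (eqbRL (invr_gt0 _) p0)).
(* The law of the pair [f] conditionally on [E]; the structure of measure on an image
   is named explicitly since it depends on the proof that [f] is measurable. *)
pose m : {measure set (R * R) -> \bar R} := mscale k
  (measure_function_pushforward__canonical__measure_function_Measure
    (mrestr P mE) mf).
pose C' := [set z : R * R | C (z.1 + z.2)].
have mC' : measurable C'.
  by rewrite -[X in measurable X]setTI; exact: (@measurable_add R).
have h : prod_law (convolution_power V n) V C' = m C'.
  apply: product_measure_unique => // A B mA mB.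
  transitivity (k%:num%:E * P ([set w | (A `*` B) (f w)] `&` E))%E; first by [].
  have -> : [set w | (A `*` B) (f w)] `&` E =
      [set w | A (\sum_(i < n) Z i w)] `&` ([set w | B (Z n w)] `&` E).
    by rewrite setIA.
  rewrite IH//; last first.
  - exact: rIH.
  - by apply: measurableI => //; exact: measurable_preimage.
  rewrite rn// muleCA [in X in (_ * X)%E]muleCA -[P E]fineK ?fin_num_measure//.
  by rewrite -EFinM/= mulVf ?gt_eqF// mule1.
have -> : convolution_power V n.+1 C = m C' by rewrite -h.
have -> : [set w | C (\sum_(i < n.+1) Z i w)] `&` E =
    [set w | C' (f w)] `&` E.
  by congr (_ `&` _); apply/seteqP; split=> w /=; rewrite big_ord_recr.
have -> : m C' = (k%:num%:E * P ([set w | C' (f w)] `&` E))%E by [].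
rewrite muleAC -[P E]fineK ?fin_num_measure//.
by rewrite -EFinM/= mulVf ?gt_eqF// mul1e.
Qed.

End IndependentSums.

(** * Mixtures over a random index *)

Section RandomIndex.
Context (R : realType) d (T : measurableType d) (P : probability T R).
Variable N : {RV P >-> nat}.

Lemma measurable_index_eq n : measurable [set w | N w = n].
Proof.
have /(_ measurableT [set n]) := measurable_funPT N.
by rewrite setTI; apply.
Qed.

Lemma measurable_comp_index (g : nat -> \bar R) :
  measurable_fun setT (fun w => g (N w)).
Proof. by apply: (measurableT_comp _ (measurable_funPT N)). Qed.

Lemma prob_random_index (C : nat -> set T) :
  (forall n, measurable (C n)) ->
  (forall n, P ([set w | N w = n] `&` C n) =
    (P [set w | N w = n] * P (C n))%E) ->
  P [set w | C (N w) w] = (\int[P]_w P (C (N w)))%E.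
Proof.
move=> mC indep; have mN := measurable_index_eq.
have tN : trivIset setT (fun n => [set w | N w = n]).
  by apply/trivIsetP => i j _ _ /eqP ij; apply/seteqP; split=> // w [/= -> ].
have UN : \bigcup_n [set w | N w = n] = setT.
  by apply/seteqP; split=> // w _; exists (N w).
rewrite -UN ge0_integral_bigcup//; last first.
  by rewrite UN; exact: (measurable_comp_index (fun n => P (C n))).
have -> : [set w | C (N w) w] = \bigcup_n ([set w | N w = n] `&` C n).
  by apply/seteqP; split=> [w Cw|w [n _ [/= <-]]//]; exists (N w).
rewrite measure_bigcup//=; last 2 first.
- by move=> n _; exact: measurableI.
- by apply: trivIset_setIr.
rewrite eseries_mkcond; apply: eq_eseriesr => n _; rewrite in_setT.
rewrite indep muleC -integral_cst//.
by apply: eq_integral => w; rewrite inE/= => ->.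
Qed.

End RandomIndex.

Section DominatedRandomIndex.
Context (R : realType) d (T : measurableType d) (P : probability T R).
Variable N : {RV P >-> nat}.

(** Dominated convergence along the continuous parameter [x]. *)
Lemma cvg_expectation_index (a : nat -> R -> R) (b : nat -> R) (l : nat -> R) :
  (forall n x, 0 <= x -> `|a n x| <= b n) ->
  (forall n, a n x @[x --> +oo] --> l n) ->
  (\int[P]_w (b (N w))%:E < +oo)%E ->
  fine (\int[P]_w (a (N w) x)%:E) @[x --> +oo] -->
    fine (\int[P]_w (l (N w))%:E).
Proof.
move=> ab al bfin.
have b0 n : 0 <= b n by apply: le_trans (ab n 0 _).
have mN (g : nat -> R) : measurable_fun setT (fun w => (g (N w))%:E).
  exact: (measurable_comp_index N (fun n => (g n)%:E)).
have ib : P.-integrable setT (fun w => (b (N w))%:E).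
  apply/integrableP; split; first exact: mN.
  by under eq_integral do rewrite gee0_abs ?lee_fin//.
(* The domination only holds for nonnegative arguments. *)
pose h x := fine (\int[P]_w (a (N w) (Num.max 0 x))%:E).
suff : h x @[x --> +oo] --> fine (\int[P]_w (l (N w))%:E).
  apply: near_eq_cvg_pinfty; near=> x.
  have x0 : 0 <= x by near: x; exact: near_pinfty_ge.
  by rewrite /h max_r.
apply/cvg_pinftyP => u uy.
have al' n : a n (Num.max 0 (u k)) @[k --> \oo] --> l n.
  have /cvg_pinftyP := al n; apply.
  move/cvgryPge in uy; apply/cvgryPge => B.
  by apply: filterS (uy B) => k uk; rewrite le_max uk orbT.
have alE w : (a (N w) (Num.max 0 (u k)))%:E @[k --> \oo] --> (l (N w))%:E.
  by apply: cvg_EFin; [exact: nearW|exact: al'].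
have abE w k : (`|(a (N w) (Num.max 0 (u k)))%:E| <= (b (N w))%:E)%E.
  by rewrite lee_fin ab// le_max lexx.
have [il _ cl] := @dominated_convergence _ _ _ P setT measurableT
  (fun k w => (a (N w) (Num.max 0 (u k)))%:E) (fun w => (l (N w))%:E)
  (fun w => (b (N w))%:E) (fun k => mN (a^~ (Num.max 0 (u k)))) (mN l)
  (aeW P (fun w _ => alE w)) ib
  (aeW P (fun w k _ => abE w k)).
apply: fine_cvg; rewrite fineK//; exact: integrable_fin_num.
Unshelve. all: by end_near. Qed.

End DominatedRandomIndex.

(** * Sums of a fixed number of vectors *)

Lemma bonferroni_pow (R : realType) (t : R) n : 0 <= t <= 1 ->
  n%:R * t - n%:R ^+ 2 * t ^+ 2 <= 1 - (1 - t) ^+ n.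
Proof.
move=> /andP[t0 t1]; elim: n => [|n IH]; first by rewrite expr0 expr0n/=; lra.
have t1' : 0 <= 1 - t by rewrite subr_ge0.
have h := ler_wpM2l t1' IH.
have h0 : 0 <= (n%:R ^+ 2 * t + n%:R + 1) * t ^+ 2.
  by rewrite mulr_ge0 ?exprn_ge0// !addr_ge0// mulr_ge0// exprn_ge0.
rewrite [in leRHS]exprS -natr1; move: h h0; set p := (1 - t) ^+ n; set m := n%:R.
by move=> h h0; lra.
Qed.

Section SumsOfVectors.
Context (R : realType) (d : nat) (A : rare_set R d).
Context disp (T : measurableType disp) (P : probability T R).
Context (F : probability 'rV[R]_d R) (X : nat -> {RV P >-> 'rV[R]_d}).
Hypothesis X_orthant : forall i w, orthant (X i w).
Hypothesis X_indep : mutually_independent X.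
Hypothesis X_law : forall i B, measurable B -> distribution P (X i) B = F B.

Let V := law_Y A F.
Let Z i w := Yfun A (X i w).

Lemma measurable_Yfun_X i : measurable_fun setT (Z i).
Proof. by apply: (measurableT_comp (measurable_Yfun A)); exact: measurable_funPT. Qed.

Lemma measurable_Yfun_preimage (C : set R) : measurable C ->
  measurable (Yfun A @^-1` C).
Proof.
by move=> mC; rewrite -[X in measurable X]setTI; exact: measurable_Yfun.
Qed.

Lemma Yfun_product_rule n : product_rule P V Z n setT.
Proof.
move=> B mB; rewrite setIT probability_setT mule1.
have memJ i : (i \in seq_fset tt (iota 0 n)) = (i < n)%N.
  by rewrite seq_fsetE mem_iota.
have -> : [set w | forall i, (i < n)%N -> B i (Z i w)] =
    \bigcap_(i in [set` seq_fset tt (iota 0 n)]) X i @^-1` (Yfun A @^-1` B i).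
  apply/seteqP; split=> w h i /=.
    by move=> iJ; apply: h; rewrite -memJ; exact: iJ.
  by move=> lin; apply: h; rewrite -memJ in lin; exact: lin.
rewrite X_indep; last by move=> i; exact: measurable_Yfun_preimage.
have := seq_fset_perm tt (iota 0 n); rewrite undup_id ?iota_uniq// => pJ.
rewrite (perm_big _ pJ)/=.
rewrite -[RHS](big_mkord xpredT (fun i => V (B i))) /index_iota subn0.
apply: eq_bigr => i _.
exact: (X_law i (measurable_Yfun_preimage (mB i))).
Qed.

Let Sn n w := \sum_(i < n) X i w.

Lemma measurable_vector_sum n : measurable_fun setT (Sn n).
Proof.
apply: measurable_rV => j.
rewrite (_ : (fun w => _) = fun w => \sum_(i < n) X i w ord0 j); last first.
  by apply/funext => w; rewrite summxE.
apply: measurable_sum => i.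
exact: (measurableT_comp (@measurable_coord R d j) (measurable_funPT (X i))).
Qed.

Lemma measurable_Yfun_sum_gt n x : measurable [set w | x < Yfun A (Sn n w)].
Proof.
rewrite (_ : [set w | _] = Sn n @^-1` (Yfun A @^-1` `]x, +oo[%classic)).
  rewrite -[X in measurable X]setTI; apply: measurable_vector_sum => //.
  exact: measurable_Yfun_preimage.
by apply/seteqP; split=> w /=; rewrite in_itv/= andbT.
Qed.

Definition Yfun_sum_tail n x : R := fine (P [set w | x < Yfun A (Sn n w)]).

(** By subadditivity, the scale of a sum is at most the sum of the scales. *)
Lemma Yfun_sum_tail_le n x : Yfun_sum_tail n x <= tail (convolution_power V n) x.
Proof.
rewrite /tail -[X in _ <= fine X]mule1 -(probability_setT P).
rewrite -(partial_sum_law measurable_Yfun_X measurableT (Yfun_product_rule n))//.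
rewrite setIT; apply: fine_prob_le.
- exact: measurable_Yfun_sum_gt.
- apply: measurable_preimage => //; apply: measurable_partial_sum.
  exact: measurable_Yfun_X.
move=> w /= h; rewrite in_itv/= andbT; apply: (lt_le_trans h).
exact: Yfun_sum_le.
Qed.

(** By monotonicity, the scale of a sum is at least each of the scales, whence the
    probability that the largest of them exceeds [x]. *)
Lemma Yfun_sum_tail_ge n x : 1 - (1 - tail V x) ^+ n <= Yfun_sum_tail n x.
Proof.
have mx : forall i : nat, measurable (`]-oo, x]%classic : set R) by [].
have := Yfun_product_rule n mx; rewrite setIT probability_setT mule1.
rewrite big_const_ord => h.
pose E := [set w | forall i, (i < n)%N -> (`]-oo, x]%classic : set R) (Z i w)].
have mE : measurable E.
  rewrite (_ : E = \bigcap_i [set w | (i < n)%N -> Z i w <= x]).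
    apply: bigcapT_measurable => i.
    have [lin|_] := ltnP i n; last first.
      by rewrite (_ : [set w | _] = setT)//; apply/seteqP; split.
    rewrite (_ : [set w | _] = [set w | (`]-oo, x]%classic : set R) (Z i w)]).
      by apply: measurable_preimage => //; exact: measurable_Yfun_X.
    by apply/seteqP; split=> w /=; rewrite in_itv/= => // /(_ isT).
  apply/seteqP; split=> w h' i => [_ lin|lin]; have := h' i; rewrite /= in_itv/=.
    exact.
  by move=> /(_ I lin).
have <- : fine (P E) = (1 - tail V x) ^+ n.
  rewrite h -fine_prob_setNyc; elim: n {h E mE} => // n IH.
  rewrite iterS exprS -IH fineM ?fin_num_measure//.
  by elim: n {IH} => //= n IH; rewrite fin_numM ?fin_num_measure.
rewrite -fine_probC//; apply: fine_prob_le.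
- exact: measurableC.
- exact: measurable_Yfun_sum_gt.
move=> w /= nE; rewrite ltNge; apply/negP => h'; apply: nE => i lin /=.
rewrite in_itv/=; apply: le_trans h'.
exact: (@Yfun_le_sum _ _ A n (fun i => X i w) (Ordinal lin)).
Qed.

Lemma Yfun_sum_tail_ratio n : doubling_tail V ->
  Yfun_sum_tail n x / tail V x @[x --> +oo] --> (n%:R : R).
Proof.
move=> dV; have [nV V0 _] := dV.
have u := tail_ratio_convolution_power (n := n) dV nV (tail_ratio_refl dV).
rewrite mulr1 in u.
have l : n%:R - n%:R ^+ 2 * tail V x @[x --> +oo] --> (n%:R : R).
  rewrite -[X in _ --> X]subr0 -(mulr0 (n%:R ^+ 2)).
  apply: cvgB; first exact: cvg_cst.
  by apply: cvgM; [exact: cvg_cst|exact: tail_cvg0].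
apply: (squeeze_cvgr _ l u); near=> x.
have x0 : 0 <= x by near: x; exact: near_pinfty_ge.
have Vx := V0 _ x0.
rewrite ler_pdivlMr// ler_pM2r ?invr_gt0// Yfun_sum_tail_le andbT.
apply: le_trans (Yfun_sum_tail_ge n x).
have t01 : 0 <= tail V x <= 1 by rewrite tail_ge0 tail_le1.
by apply: le_trans (bonferroni_pow n t01); lra.
Unshelve. all: by end_near. Qed.

(** Independence of [N] is only assumed from events of the sigma-algebra generated by
    the sequence. With that sigma-algebra on the sample space all the vectors, hence their
    partial sums, are measurable. *)
Lemma sigma_generated_vector_sum n (U : set 'rV[R]_d) : measurable U ->
  sigma_generated X (Sn n @^-1` U).
Proof.
move=> mU.
pose G : set (set T) := \bigcup_i [set X i @^-1` B | B in measurable].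
pose TG := g_sigma_algebraType G.
pose XG i : TG -> 'rV[R]_d := X i.
have mX i : measurable_fun setT (XG i).
  move=> _ B mB; rewrite setTI; apply: sub_sigma_algebra.
  by exists i => //; exists B.
have : measurable_fun setT (fun w : TG => \sum_(i < n) XG i w).
  apply: measurable_rV => j.
  rewrite (_ : (fun w => _) = fun w => \sum_(i < n) XG i w ord0 j); last first.
    by apply/funext => w; rewrite summxE.
  apply: measurable_sum => i.
  exact: (measurableT_comp (@measurable_coord R d j) (mX i)).
by move=> /(_ measurableT U mU); rewrite setTI.
Qed.

End SumsOfVectors.

(** * Sums of a random number of vectors *)

Section CompoundSums.
Context (R : realType) (d : nat) (A : rare_set R d).
Context disp (T : measurableType disp) (P : probability T R).
Context (F : probability 'rV[R]_d R) (X : nat -> {RV P >-> 'rV[R]_d}).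
Context (N : {RV P >-> nat}).
Hypothesis X_orthant : forall i w, orthant (X i w).
Hypothesis X_indep : mutually_independent X.
Hypothesis X_law : forall i B, measurable B -> distribution P (X i) B = F B.
Hypothesis N_indep : independent_of_sequence N X.

Let V := law_Y A F.
Let G := law_Y A (distribution P (random_sum X N)).
Let q := Yfun_sum_tail A X.

Lemma law_random_sum_gt x :
  G `]x, +oo[%classic = (\int[P]_w (q (N w) x)%:E)%E.
Proof.
transitivity (P [set w | x < Yfun A (random_sum X N w)]).
  by congr (P _); apply/seteqP; split=> w /=; rewrite in_itv/= andbT.
have /= -> := @prob_random_index _ _ _ P N
  (fun n => [set w | x < Yfun A (\sum_(i < n) X i w)]).
- apply: eq_integral => w _; rewrite /q /Yfun_sum_tail fineK// fin_num_measure//.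
  exact: measurable_Yfun_sum_gt.
- by move=> n; exact: measurable_Yfun_sum_gt.
move=> n; apply: (N_indep (B := [set n])) => //.
rewrite (_ : [set w | _] = (fun w => \sum_(i < n) X i w) @^-1`
    (Yfun A @^-1` `]x, +oo[%classic)).
  by apply: sigma_generated_vector_sum; exact: measurable_Yfun_preimage.
by apply/seteqP; split=> w /=; rewrite in_itv/= andbT.
Qed.

Lemma tail_ratio_random_sum (eps : R) : doubling_tail V -> 0 < eps ->
  ('E_P[(fun w => (1 + eps) ^+ N w)%R] < +oo)%E ->
  tail_ratio G V (fine 'E_P[(fun w => (N w)%:R)%R]).
Proof.
move=> dV eps0; rewrite !unlock => Nexp; have [nV V0 _] := dV.
have [K K0 HK] := kesten_bound dV eps0.
have e1 : 0 <= 1 + eps by rewrite addr_ge0// ltW.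
have h : fine (\int[P]_w (q (N w) x / tail V x)%:E) @[x --> +oo] -->
    fine (\int[P]_w ((N w)%:R)%:E).
  apply: (@cvg_expectation_index _ _ _ P N (fun n x => q n x / tail V x)
    (fun n => K * (1 + eps) ^+ n) (fun n => n%:R)).
  - move=> n x x0; have Vx := V0 _ x0.
    rewrite ger0_norm; last by rewrite divr_ge0 ?tail_ge0// fine_prob_ge0.
    rewrite ler_pdivrMr//; apply: le_trans (HK n x x0).
    exact: Yfun_sum_tail_le.
  - by move=> n; exact: Yfun_sum_tail_ratio.
  under eq_integral do rewrite EFinM.
  rewrite ge0_integralZl//.
  - by apply: lte_mul_pinfty.
  - exact: (measurable_comp_index N (fun n => ((1 + eps) ^+ n)%:E)).
  - by move=> w _; rewrite lee_fin exprn_ge0.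
apply: near_eq_cvg_pinfty h; near=> x.
rewrite /tail law_random_sum_gt.
have qm : measurable_fun setT (fun w => (q (N w) x)%:E).
  exact: (measurable_comp_index N (fun n => (q n x)%:E)).
under eq_integral do rewrite EFinM.
rewrite ge0_integralZr//; last 2 first.
- by move=> w _; rewrite lee_fin fine_prob_ge0.
- by rewrite lee_fin invr_ge0 tail_ge0.
rewrite fineM//.
by rewrite -law_random_sum_gt fin_num_measure.
Unshelve. all: by end_near. Qed.

(** The Markov inequality at level 1. *)
Lemma expectation_gt0 : P [set w | N w = 0%N] != 1%E ->
  ('E_P[(fun w => (N w)%:R)%R] < +oo)%E ->
  0 < fine 'E_P[(fun w => (N w)%:R)%R].
Proof.
move=> N0 Nfin; rewrite fine_gt0// Nfin andbT.
have mN := measurable_index_eq N 0.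
apply: (@lt_le_trans _ _ (P (~` [set w | N w = 0%N]))).
  rewrite probability_setC// sube_gt0 lt_neqAle N0/=; exact: probability_le1.
rewrite unlock -[leLHS]mul1e -[X in (X * _)%E]/(1%:E).
rewrite -integral_cst; last exact: measurableC.
rewrite integral_mkcond; apply: ge0_le_integral => //.
- by move=> w _; rewrite patchE; case: ifP.
- by apply/(measurable_restrictT _ _).1 => //; exact: measurableC.
- exact: (measurable_comp_index N (fun n => (n%:R)%:E)).
move=> w _; rewrite patchE; case: ifPn => [|_]; last by rewrite lee_fin.
by rewrite inE/= => /eqP; rewrite -lt0n => Nw; rewrite lee_fin ler1n.
Qed.

End CompoundSums.

Theorem theorem4p2 (R : realType) (d : nat) (d_gt0 : (0 < d)%N)
    (A : rare_set R d)
    (disp : measure_display) (T : measurableType disp) (P : probability T R)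
    (F : probability 'rV[R]_d R)
    (X : nat -> {RV P >-> 'rV[R]_d}) (N : {RV P >-> nat})
    (X_orthant : forall i w, @orthant R d (X i w))
    (X_indep : mutually_independent X)
    (X_law : forall i B, measurable B -> distribution P (X i) B = F B)
    (F_SA : SA A F)
    (N_nondegenerate : P [set w | N w = 0%N] != 1%E)
    (N_indep : independent_of_sequence N X)
    (N_mean : ('E_P[(fun w => (N w)%:R)%R] < +oo)%E)
    (N_exp : exists2 eps : R, 0 < eps &
       ('E_P[(fun w => (1 + eps) ^+ N w)%R] < +oo)%E) :
  asymp_equiv
    (fun x => fine (P [set w | dilate x A (random_sum X N w)]))
    (fun x => fine ('E_P[(fun w => (N w)%:R)%R])%E * fine (F (dilate x A)))
  /\ SA A (distribution P (random_sum X N)).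
Proof.
have [eps eps0 Neps] := N_exp.
have dV := subexponential_doubling F_SA.2.
have c0 := expectation_gt0 N_nondegenerate N_mean.
set c := fine _ in c0 *.
have GV := tail_ratio_random_sum X_orthant X_indep X_law N_indep dV eps0 Neps.
rewrite -/c in GV; split.
  have h : c^-1 * (tail (law_Y A (distribution P (random_sum X N))) x /
      tail (law_Y A F) x) @[x --> +oo] --> (1 : R).
    rewrite -[X in _ --> X](mulVf (lt0r_neq0 c0)).
    by apply: cvgM; [exact: cvg_cst|exact: GV].
  apply: near_eq_cvg_pinfty h; near=> x.
  have x0 : 0 < x by near: x; exact: nbhs_pinfty_gt (num_real _).
  have dilE : Yfun A @^-1` `]x, +oo[%classic = dilate x A.
    apply/seteqP; split=> z /=; rewrite in_itv/= andbT => h; exact/lt_Yfun.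
  have -> : tail (law_Y A F) x = fine (F (dilate x A)) by rewrite -dilE.
  have -> : tail (law_Y A (distribution P (random_sum X N))) x =
      fine (P [set w | dilate x A (random_sum X N w)]) by rewrite -dilE.
  by rewrite invfM mulrCA mulrA.
split.
  rewrite -(probability_setT P); congr (P _); apply/seteqP; split=> // w _ /=.
  exact: orthant_sum.
apply: (subexponential_tail_ratio dV _ c0 GV).
rewrite /nonneg_law -(probability_setT P); congr (P _).
by apply/seteqP; split=> // w _ /=; rewrite in_itv/= andbT Yfun_ge0.
Unshelve. all: by end_near. Qed.
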